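(* For all $m\in\mathbb{N}_0=\{0,1,2,\dotsc\}$ and all $n\in\mathbb{Z}$, $$ \sum_{k=0}^{m}\frac{2^k}{k!}\binom{2m-2k}{m-k}\sum_{\ell=0}^{k}\frac{(-1)^\ell}{2^\ell}\frac{(2k-2\ell-1)!!}{(n-\ell)!}\binom{2k-\ell-1}{\ell-1}=\frac{1}{n!}\binom{2m-n}{m}, $$ where $\frac{1}{r!}$ is understood as $0$ for every negative integer $r$.
   Context: Double factorials: $(2r-1)!!=1\cdot3\dotsm(2r-1)$ for $r\ge1$ and $(-1)!!=1$. Extended binomial coefficients: for integer $w\ge0$ and any $x\in\mathbb{C}$ (including negative integers), $\binom{x}{w}=\frac{x(x-1)\dotsm(x-w+1)}{w!}$; for integer $w<0$ and $x$ not a negative integer, $\binom{x}{w}=0$; and $\binom{-1}{-1}=1$. (Thus $\binom{2k-\ell-1}{\ell-1}$ equals $1$ for $k=\ell=0$, and equals $0$ for $k\ge1$, $\ell=0$.) *)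

(* Defs.v *)
From HB Require Import structures.
From mathcomp Require Import all_boot all_order all_algebra.
Set Implicit Arguments.
Unset Strict Implicit.
Unset Printing Implicit Defensive.
Import Order.TTheory GRing.Theory Num.Theory.
Local Open Scope ring_scope.

(* (2r - 1)!! = 1 * 3 * ... * (2r - 1); the empty product gives (-1)!! = 1. *)
Definition odd_dfact (r : nat) : nat := (\prod_(i < r) (2 * i + 1))%N.

(* 1 / r! for an integer r, with the convention 1 / r! = 0 for r < 0. *)
Definition inv_fact (r : int) : rat :=
  match r with
  | Posz k => (k`!%:R)^-1
  | Negz _ => 0
  end.

(* For w < 0 the mathematical convention covers only x not a negative integer
   (value 0) and x = w = -1 (value 1); elsewhere 0 is a junk value. *)
Definition ebinom (F : numFieldType) (x : F) (w : int) : F :=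
  match w with
  | Posz k => (\prod_(i < k) (x - i%:R)) / k`!%:R
  | Negz _ => if (x == -1) && (w == -1) then 1 else 0
  end.

(* Main.v *)
(* After multiplication by n!, put l = j + 1: for k >= 1 the inner sum with its
   factor 2^k/k! is -(n/k) * sum_j (-1)^j C(n-1,j) C(2k-2-j,k-1), which equals
   b_k(n) = -(n/k) binom(2k-n-1,k-1), the coefficient of z^k in c(z)^(-n) where
   c = 1 + z c^2 is the Catalan series.  The identity
   sum_k C(2m-2k,m-k) b_k(x) = binom(2m-x,m) then holds for all integers x:
   dividing c = 1 + z c^2 by c^(x+1) shows that both sides satisfy
   f_(m+1)(x+1) = f_(m+1)(x) - f_m(x-1), and they agree at x = 0. *)
Require Import Defs.
From mathcomp Require Import all_boot all_order all_algebra.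
From mathcomp Require Import ring zify.
Import Order.TTheory GRing.Theory Num.Theory.
Local Open Scope ring_scope.

Lemma natr1_neq0 (F : numFieldType) (k : nat) : k%:R + 1 != 0 :> F.
Proof. by rewrite natr1 pnatr_eq0. Qed.

Lemma fact_neq0 (F : numFieldType) (k : nat) : k`!%:R != 0 :> F.
Proof. by rewrite pnatr_eq0 -lt0n fact_gt0. Qed.

Lemma natr_factS (F : numFieldType) (k : nat) :
  k.+1`!%:R = (k%:R + 1) * k`!%:R :> F.
Proof. by rewrite factS natrM natr1. Qed.

Lemma natr_bin (F : numFieldType) (a b : nat) :
  'C(a + b, b)%:R = (a + b)`!%:R / (a`!%:R * b`!%:R) :> F.
Proof.
rewrite -(bin_fact (leq_addl a b)) addnK !natrM.
by field; rewrite !fact_neq0.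
Qed.

Lemma ebinom0 (F : numFieldType) (x : F) : ebinom x 0%N = 1.
Proof. by rewrite /ebinom big_ord0 fact0 divr1. Qed.

Lemma ebinomSl (F : numFieldType) (x : F) (k : nat) :
  ebinom x k.+1 = x / (k%:R + 1) * ebinom (x - 1) k.
Proof.
rewrite /ebinom big_ord_recl subr0 natr_factS.
have -> : \prod_(i < k) (x - (lift ord0 i)%:R) = \prod_(i < k) (x - 1 - i%:R).
  by apply: eq_bigr => i _; rewrite /= /bump /= natrD opprD addrA.
by field; rewrite fact_neq0 natr1_neq0.
Qed.

Lemma ebinomSr (F : numFieldType) (x : F) (k : nat) :
  ebinom x k.+1 = (x - k%:R) / (k%:R + 1) * ebinom x k.
Proof.
rewrite /ebinom big_ord_recr natr_factS /=.
by field; rewrite fact_neq0 natr1_neq0.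
Qed.

Lemma ebinom_pascal (F : numFieldType) (x : F) (k : nat) :
  ebinom x k.+1 = ebinom (x - 1) k.+1 + ebinom (x - 1) k.
Proof. by rewrite ebinomSl ebinomSr; field; rewrite natr1_neq0. Qed.

Lemma ebinom_nat (F : numFieldType) (n k : nat) :
  ebinom (n%:R : F) k = 'C(n, k)%:R.
Proof.
elim: n k => [|n IHn] [|k]; rewrite ?ebinom0 ?bin0 //.
  by rewrite ebinomSl !mul0r.
by rewrite ebinom_pascal -natr1 addrK !IHn binS natrD.
Qed.

(** Both sides are the coefficient of z^p in (1-z)^y (1-z)^(-q-1). The induction on y uses Pascal's
    rule on each side: multiplying by one more factor 1-z subtracts the value for p-1. *)
Lemma alternating_vandermonde (F : numFieldType) (y p q : nat) :
  \sum_(j < p.+1) (-1) ^+ j * 'C(y, j)%:R * 'C(p + q - j, q)%:R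
    = ebinom ((p + q)%:R - y%:R : F) p.
Proof.
elim: y p => [|y IHy] p.
  rewrite big_ord_recl big1 => [|i _]; last by rewrite mulr0 mul0r.
  by rewrite subr0 ebinom_nat expr0 !mul1r addr0 subn0 -bin_sub ?leq_addl ?addnK.
case: p => [|p].
  by rewrite big_ord1 ebinom0 expr0 bin0 !mul1r subn0 binn.
have pascal : ebinom ((p.+1 + q)%:R - y.+1%:R : F) p.+1
    = ebinom ((p.+1 + q)%:R - y%:R) p.+1 - ebinom ((p + q)%:R - y%:R) p.
  rewrite [in RHS]ebinom_pascal addSn -!natr1.
  have -> : (p + q)%:R + 1 - y%:R - 1 = (p + q)%:R - y%:R :> F by ring.
  by rewrite addrK; congr ebinom; ring.
rewrite pascal -!IHy !(big_ord_recl p.+1) !bin0 -addrA; congr +%R.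
rewrite -sumrB; apply: eq_bigr => i _.
rewrite lift0 binS natrD exprS addSn subSS.
by ring.
Qed.

Lemma odd_dfactE (r : nat) :
  (odd_dfact r)%:R = (2 * r)`!%:R / (2 ^+ r * r`!%:R) :> rat.
Proof.
elim: r => [|r IHr]; first by rewrite /odd_dfact big_ord0 muln0 divr1.
have -> : odd_dfact r.+1 = (odd_dfact r * (2 * r + 1))%N.
  by rewrite /odd_dfact big_ord_recr.
rewrite natrM IHr (mulnS 2 r) !natr_factS exprS -natr1 natrD natrM.
by field; rewrite fact_neq0 natr1_neq0 expf_neq0.
Qed.

(* The coefficient of z^k in c(z)^(-x), where c = 1 + z c^2. *)
Definition catalan_pow (k : nat) (x : rat) : rat :=
  if k is k'.+1 then - (x / (k'%:R + 1)) * ebinom (2 * k'%:R + 1 - x) k' else 1.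

Lemma catalan_powS (k : nat) (x : rat) :
  catalan_pow k.+1 (x + 1) = catalan_pow k.+1 x - catalan_pow k (x - 1).
Proof.
rewrite /catalan_pow; case: k => [|k]; first by rewrite !ebinom0; field.
(* All three binomials become multiples of [ebinom (2 * k%:R + 1 - (x - 1)) k]. *)
rewrite [in RHS]ebinomSl [in LHS]ebinomSr -natr1.
have -> : 2 * (k%:R + 1) + 1 - (x + 1) = 2 * k%:R + 1 - (x - 1) by ring.
have -> : 2 * (k%:R + 1) + 1 - x - 1 = 2 * k%:R + 1 - (x - 1) by ring.
field; rewrite natr1_neq0 /=.
by have := @natr1_neq0 rat k.+1; rewrite -natr1.
Qed.

Lemma sum_central_catalan_pow (m : nat) (x : int) :
  \sum_(k < m.+1) 'C(2 * (m - k), m - k)%:R * catalan_pow k x%:~R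
    = ebinom (2 * m%:R - x%:~R) m.
Proof.
elim: m x => [|m IHm] x; first by rewrite big_ord1 ebinom0 mulr1.
(* The defect of the claim at [m.+1]. It has period 1 in x, because the induction hypothesis at
   [z - 1] matches the two correction terms, and it vanishes at 0. *)
pose D (x : int) := \sum_(k < m.+2)
  'C(2 * (m.+1 - k), m.+1 - k)%:R * catalan_pow k x%:~R
  - ebinom (2 * m.+1%:R - x%:~R) m.+1.
have DS z : D (z + 1) = D z.
  rewrite /D !(big_ord_recl m.+1) intrD.
  rewrite [in RHS]ebinom_pascal.
  have -> : 2 * m.+1%:R - z%:~R - 1 = 2 * m.+1%:R - (z%:~R + 1) :> rat by ring.
  have := IHm (z - 1); rewrite intrB.
  have -> : 2 * m%:R - (z%:~R - 1) = 2 * m.+1%:R - (z%:~R + 1) :> rat.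
    by rewrite -natr1; ring.
  move=> <-.
  under eq_bigr => i _ do rewrite lift0 catalan_powS mulrBr subSS.
  rewrite sumrB.
  rewrite -[catalan_pow _ (_ + 1)]/1 -[catalan_pow _ z%:~R]/1.
  under [in RHS]eq_bigr => i _ do rewrite lift0 subSS.
  by ring.
(* The factor x of [catalan_pow] kills every term but k = 0, a central binomial coefficient. *)
have D0 : D 0 = 0.
  rewrite /D big_ord_recl big1 => [|i _]; last by rewrite /= mul0r oppr0 mul0r mulr0.
  by rewrite addr0 mulr0z -natrM subr0 ebinom_nat mulr1 subn0 subrr.
have Dx : D x = 0.
  elim/int_ind: x => [|n IHn|n IHn] //.
    by rewrite -addn1 PoszD DS.
  by rewrite -DS -IHn; congr D; lia.
by apply/eqP; rewrite -subr_eq0; apply/eqP.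
Qed.

(** With r = k - j, the (2r)! in (2r-1)!! = (2r)!/(2^r r!) cancels against C(2r+j, j), and the
    powers of 2 cancel because k = r + j. *)
Lemma inner_term (k j n : nat) : (j <= k)%N ->
  2 ^+ k.+1 / k.+1`!%:R *
     ((-1) ^+ j.+1 / 2 ^+ j.+1
      * ((odd_dfact (k.+1 - j.+1))%:R * inv_fact (n.+1%:Z - j.+1%:Z))
      * ebinom ((2 * k.+1%:Z - j.+1%:Z - 1)%:~R : rat) (j.+1%:Z - 1))
  = inv_fact n.+1 * (- (n.+1%:R / (k%:R + 1)) *
      ((-1) ^+ j * 'C(n, j)%:R * 'C(k + k - j, k)%:R)).
Proof.
move=> /subnK; set r := (k - j)%N => <-.
rewrite subSS addnK.
have -> : 2 * (r + j).+1%:Z - j.+1%:Z - 1 = (2 * r + j)%N%:Z by lia.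
have -> : j.+1%:Z - 1 = j by lia.
have -> : (r + j + (r + j) - j = r + (r + j))%N by lia.
rewrite -pmulrn ebinom_nat !natr_bin odd_dfactE.
have -> : (r + (r + j) = 2 * r + j)%N by lia.
(* For n < j both sides vanish: 1/(n-j)! = 0 and C(n, j) = 0. *)
have [nj|/subnK] := ltnP n j.
  have -> : n.+1%:Z - j.+1%:Z = Negz (j - n).-1 by lia.
  by rewrite bin_small // !(mulr0, mul0r).
set s := (n - j)%N => <-.
have -> : (s + j).+1%:Z - j.+1%:Z = s by lia.
rewrite natr_bin /inv_fact !natr_factS !exprS !exprD -!natr1 !natrD.
have rj : r%:R + j%:R + 1 != 0 :> rat by rewrite -natrD natr1_neq0.
have sj : s%:R + j%:R + 1 != 0 :> rat by rewrite -natrD natr1_neq0.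
by field; rewrite ?fact_neq0 ?expf_neq0 ?rj ?sj.
Qed.

Lemma inner_sum (k n : nat) :
  2 ^+ k / k`!%:R *
     (\sum_(l < k.+1)
        (-1) ^+ l / 2 ^+ l
        * ((odd_dfact (k - l))%:R * inv_fact (n%:Z - l%:Z))
        * ebinom ((2 * k%:Z - l%:Z - 1)%:~R : rat) (l%:Z - 1))
  = inv_fact n * catalan_pow k n%:R.
Proof.
case: k => [|k].
  (* The only term is l = 0, where the convention binom(-1,-1) = 1 applies. *)
  by rewrite big_ord1 /odd_dfact big_ord0 subr0 /= !(divr1, mul1r, mulr1).
rewrite big_ord_recl.
(* The lower entry is -1 but the upper one is 2k+1 >= 0, so the l = 0 term drops out. *)
have -> : ebinom ((2 * k.+1%:Z - 0%N%:Z - 1)%:~R : rat) (0%N%:Z - 1) = 0.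
  by rewrite /ebinom /= gt_eqF // (lt_le_trans (ltrN10 _)) // ler0z; lia.
rewrite mulr0 add0r mulr_sumr.
(* At n = 0 every 1/(n-l)! with l >= 1 is 0, as is the factor n of [catalan_pow]. *)
case: n => [|n].
  rewrite /catalan_pow mul0r oppr0 mul0r mulr0 big1 // => i _.
  by rewrite !(mulr0, mul0r).
rewrite /catalan_pow.
(* Prepares [alternating_vandermonde] with p = q = k and y = n. *)
have -> : 2 * k%:R + 1 - n.+1%:R = (k + k)%:R - n%:R :> rat.
  by rewrite -natr1 natrD; ring.
rewrite -alternating_vandermonde !mulr_sumr; apply: eq_bigr => i _.
by rewrite -inner_term -1?ltnS ?ltn_ord.
Qed.

Theorem corollary4p1 (m : nat) (n : int) :
  \sum_(0 <= k < m.+1)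
     2 ^+ k / k`!%:R * 'C(2 * m - 2 * k, m - k)%:R *
     (\sum_(0 <= l < k.+1)
        (-1) ^+ l / 2 ^+ l
        * ((odd_dfact (k - l))%:R * inv_fact (n - l%:Z))
        * ebinom ((2 * k%:Z - l%:Z - 1)%:~R : rat) (l%:Z - 1))
  = inv_fact n * ebinom ((2 * m%:Z - n)%:~R : rat) m%:Z.
Proof.
case: n => n; last first.
  rewrite mul0r big1 // => k _; rewrite big1 ?mulr0 // => l _.
  have -> : Negz n - l%:Z = Negz (n + l) by lia.
  by rewrite !(mulr0, mul0r).
have -> : (2 * m%:Z - n%:Z)%:~R = 2 * m%:R - n%:Z%:~R :> rat.
  by rewrite intrB intrM.
(* Expanding the closed form as a convolution leaves one comparison for each k, settled by
   [inner_sum]. *)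
rewrite -sum_central_catalan_pow mulr_sumr big_mkord; apply: eq_bigr => k _.
by rewrite mulrCA -inner_sum big_mkord mulrA -mulnBr ['C(_, _)%:R * (_ / _)]mulrC.
Qed.
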